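(* Let $w$ be an $LR$ word, and denote by $|w|_L$ and $|w|_R$ the numbers of letters $L$ and $R$ in $w$, respectively. Let $\langle\Gamma(w)\rangle=v(\phi(\alpha))\in\mathbb{Z}[A,A^{-1}]$, where $\alpha\in\mathbb{Q}\cap(0,1)$ is the rational number corresponding to $w$. Then: (1) the minimum and maximum degrees (in $A$) of $\langle\Gamma(w)\rangle$ are $-4(|w|_L+1)$ and $4(|w|_R+1)$, respectively; (2) for all $k\in\mathbb{Z}$, if the coefficient of $A^{4k}$ in $\langle\Gamma(w)\rangle$ is not $0$, then its sign is $(-1)^k$.
   Context: $LR$ words. An $LR$ word is a finite, possibly empty, word in the letters $L,R$. Consider the part of the Stern-Brocot tree below $\frac12$: the root $\frac12$ has parents $(\frac01,\frac11)$, and a vertex $\alpha$ with parents $(y,z)$ has left child $y\sharp\alpha$ (with parents $(y,\alpha)$) and right child $\alpha\sharp z$ (with parents $(\alpha,z)$). Every $\alpha\in\mathbb{Q}\cap(0,1)$ occurs exactly once; record the downward path from $\frac12$ to $\alpha$ as a sequence of letters $L$ (left step) and $R$ (right step), and let $w(\alpha)$ be this sequence written in reverse order (last step first). The map $\alpha\mapsto w(\alpha)$ is a bijection from $\mathbb{Q}\cap(0,1)$ to $LR$ words; the inverse image of $w$ is the rational number corresponding to $w$. $\Gamma(w)$ denotes the Conway-Coxeter frieze of zigzag-type determined by $w$, and $\langle\Gamma(w)\rangle$ is its Kauffman bracket polynomial. Notation. $\Lambda=\mathbb{Z}[A,A^{-1}]$, $\delta=-A^2-A^{-2}$, and $\Lambda^2=\Lambda[\infty]\oplus\Lambda[0]$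 is the free $\Lambda$-module with basis $[\infty],[0]$. The map $v:\Lambda^2\to\Lambda$ is $v(a[\infty]+b[0])=a\delta+b$. Farey sums. Irreducible fractions have non-negative denominator, with $0=\frac01$, $\infty=\frac10$. Fractions $\frac pq,\frac rs$ (listed in ascending order) are Farey neighbors if $qr-ps=1$; their Farey sum is $\frac pq\sharp\frac rs=\frac{p+r}{q+s}$. Each positive rational $\alpha$ is $y\sharp z$ for a unique pair $(y,z)$ of Farey neighbors, called the pair of parents of $\alpha$. Ancestor triangle. Let $\alpha$ be a positive rational. Put $(y_1,z_1)=(\frac01,\frac10)$ and $m_i=y_i\sharp z_i$. If $m_i=\alpha$ stop and put $N=i$; otherwise $(y_{i+1},z_{i+1})=(m_i,z_i)$ if $\alpha>m_i$ and $(y_i,m_i)$ if $\alpha<m_i$. The ancestor triangle of $\alpha$ is the planar triangle with upper left corner $\frac01$, upper right corner $\frac10$ and bottom corner $\alpha$, decomposed into the $N$ fundamental triangles with vertices $y_i$ (upper left), $z_i$ (upper right), $m_i$ (bottom), $i=1,\ldots,N$, the $(i+1)$-st glued below the $i$-th along the edge $y_{i+1}z_{i+1}$. Its left oblique side is the chain of edges through the distinct $y_i$'s from $\frac01$ down to $\alpha$, and its right oblique side is the chain of edges through the distinct $z_i$'s from $\frac10$ down to $\alpha$; $l(\alpha)$, $r(\alpha)$ are the numbers of edges on the left and right oblique sides. For $\ast\in\{0,\infty\}$, $P_\ast(\alpha)$ is the set of descending paths from $\ast$ to $\alpha$, i.e. edge paths in the ancestor triangle in which each step goes from a vertex to a vertex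 of which it is a parent. Such a path $\gamma$ cuts the ancestor triangle into a left and a right part; $w_L(\gamma)$, $w_R(\gamma)$ are the numbers of fundamental triangles on the left and on the right of $\gamma$. The map $\phi$ from the non-negative rationals together with $\infty$ to $\Lambda^2$ is defined by $\phi(\infty)=A^6[\infty]$, $\phi(0)=[0]$ and, for rational $\alpha>0$, $$\phi(\alpha)=\Bigl(A^6(-A^4)^{-r(\alpha)}\sum_{\gamma\in P_\infty(\alpha)}(-A^4)^{w_R(\gamma)}\Bigr)[\infty]+\Bigl((-A^4)^{l(\alpha)}\sum_{\gamma\in P_0(\alpha)}(-A^4)^{-w_L(\gamma)}\Bigr)[0].$$ *)

(* Defs.v *)
From HB Require Import structures.
From mathcomp Require Import all_boot all_order all_algebra.
From mathcomp Require Import boolp classical_sets functions cardinality fsbigop.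
From mathcomp Require Import zify.

Set Implicit Arguments.
Unset Strict Implicit.
Unset Printing Implicit Defensive.

Import Order.TTheory GRing.Theory Num.Theory.
Local Open Scope ring_scope.

(* The ring Z[A, A^-1], as the subring of the field Q(A) consisting of the
   p / A^n with p an integer polynomial; the variable 'X of {poly int} is A. *)

Local Notation tofrac := (@FracField.tofrac {poly int}).

Definition laurent_frac (np : nat * {poly int}) : {fraction {poly int}} :=
  tofrac np.2 / tofrac 'X^(np.1).

Definition laurent_pred : {pred {fraction {poly int}}} :=
  fun f => `[< exists np, f == laurent_frac np >].

Lemma tofracXn_neq0 n : tofrac ('X^n : {poly int}) != 0.
Proof. by rewrite tofrac_eq0 expf_neq0 // polyX_eq0. Qed.

Lemma laurent_predP f :
  reflect (exists np, f == laurent_frac np) (f \in laurent_pred).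
Proof. exact: asboolP. Qed.

Fact laurent_subring : subring_closed laurent_pred.
Proof.
split.
- apply/laurent_predP; exists (0%N, 1).
  by rewrite /laurent_frac /= expr0 tofrac1 divr1.
- move=> f g /laurent_predP[[n p] /eqP->] /laurent_predP[[m q] /eqP->].
  apply/laurent_predP; exists ((n + m)%N, p * 'X^m - q * 'X^n).
  rewrite /laurent_frac /= -mulNr addf_div ?tofracXn_neq0 //.
  by rewrite exprD -!tofracM -tofracN -tofracM -tofracD -mulNr.
- move=> f g /laurent_predP[[n p] /eqP->] /laurent_predP[[m q] /eqP->].
  apply/laurent_predP; exists ((n + m)%N, p * q).
  by rewrite /laurent_frac /= mulf_div exprD !tofracM.
Qed.

HB.instance Definition _ :=
  GRing.isSubringClosed.Build {fraction {poly int}} laurent_pred laurent_subring.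

Record laurent := Laurent {
  laurent_val :> {fraction {poly int}};
  _ : laurent_val \in laurent_pred }.

HB.instance Definition _ := [isSub for laurent_val].
HB.instance Definition _ := [Choice of laurent by <:].
HB.instance Definition _ := [SubChoice_isSubComNzRing of laurent by <:].

Definition laurent_unit : {pred laurent} :=
  fun f => (\val f != 0) && ((\val f)^-1 \in laurent_pred).

Definition laurent_inv (f : laurent) : laurent :=
  if f \in laurent_unit then insubd f (\val f)^-1 else f.

Fact laurent_mulVf : {in laurent_unit, left_inverse 1 laurent_inv *%R}.
Proof.
move=> f fU; have /andP[f0 fV] := fU.
have e : \val (laurent_inv f) = (\val f)^-1.
  by rewrite /laurent_inv fU; apply: insubdK.
by apply: val_inj; rewrite -[RHS](mulVf f0) -e.
Qed.

Fact laurent_unitP (f g : laurent) : g * f = 1 -> f \in laurent_unit.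
Proof.
move=> /(congr1 val); rewrite rmorphM rmorph1 /= => gf1.
have f0 : \val f != 0.
  by apply: contra_eq_neq gf1 => ->; rewrite mulr0 eq_sym oner_neq0.
apply/andP; split => //.
have <- : \val g = (\val f)^-1 by apply: (mulIf f0); rewrite gf1 mulVf.
exact: valP.
Qed.

Fact laurent_inv_out : {in [predC laurent_unit], laurent_inv =1 id}.
Proof. by move=> f; rewrite inE /= /laurent_inv => /negbTE->. Qed.

HB.instance Definition _ :=
  GRing.ComNzRing_hasMulInverse.Build laurent
    laurent_mulVf laurent_unitP laurent_inv_out.

Lemma laurent_valP (f : laurent) : exists np, \val f == laurent_frac np.
Proof. exact/laurent_predP/valP. Qed.

(* If f = p / A^n, the coefficient of A^k in f is that of A^(k + n) in p; this
   does not depend on the choice of (n, p), see lcoefE. *)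
Definition lcoef (f : laurent) (k : int) : int :=
  let np := xchoose (laurent_valP f) in
  if k + np.1%:Z is Posz j then np.2`_j else 0.

Lemma lcoefE (f : laurent) (n : nat) (p : {poly int}) (k : int) :
  \val f = laurent_frac (n, p) ->
  lcoef f k = if k + n%:Z is Posz j then p`_j else 0.
Proof.
rewrite /lcoef; have := xchooseP (laurent_valP f).
case: (xchoose _) => m q /= /eqP -> /eqP.
rewrite /laurent_frac /= eqr_div ?tofracXn_neq0 // -!tofracM.
rewrite tofrac_eq => /eqP e.
case km: (k + m%:Z) => [j|j]; case kn: (k + n%:Z) => [i|i] //.
- have jn : (j + n)%N = (i + m)%N.
    by apply/eqP; rewrite -eqz_nat !PoszD -km -kn addrAC.
  have := congr1 (fun r : {poly int} => r`_(j + n)) e.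
  rewrite !coefMXn [in X in _ = X]jn addnK [(j + n < n)%N]ltnNge leq_addl addnK.
  by rewrite [(i + m < m)%N]ltnNge leq_addl.
- have := congr1 (fun r : {poly int} => r`_(j + n)) e.
  rewrite !coefMXn addnK [(j + n < n)%N]ltnNge leq_addl /= => ->.
  suff -> : (j + n < m)%N by [].
  by rewrite -ltz_nat PoszD -km addrAC kn gtrDr.
- have := congr1 (fun r : {poly int} => r`_(i + m)) e.
  rewrite !coefMXn addnK [(i + m < m)%N]ltnNge leq_addl /= => <-.
  suff -> : (i + m < n)%N by [].
  by rewrite -ltz_nat PoszD -kn addrAC km gtrDr.
Qed.

Fact laurentA_subproof : tofrac ('X : {poly int}) \in laurent_pred.
Proof.
apply/laurent_predP; exists (0%N, 'X).
by rewrite /laurent_frac /= expr0 tofrac1 divr1.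
Qed.

Definition A : laurent := Laurent laurentA_subproof.

Definition is_mindeg (f : laurent) (d : int) : Prop :=
  lcoef f d != 0 /\ forall k : int, lcoef f k != 0 -> d <= k.

Definition is_maxdeg (f : laurent) (d : int) : Prop :=
  lcoef f d != 0 /\ forall k : int, lcoef f k != 0 -> k <= d.

Definition delta : laurent := - A ^ 2 - A ^ (-2).

(* The module Lambda^2: the pair (a, b) is a[oo] + b[0]. *)
Definition v (x : laurent * laurent) : laurent := x.1 * delta + x.2.

(* Q together with oo = 1/0, which is None. *)
Definition xrat := option rat.

Definition fnum (x : xrat) : int := if x is Some a then numq a else 1.
Definition fden (x : xrat) : int := if x is Some a then denq a else 0.

Definition farey_neighbors (x y : xrat) : bool :=
  fden x * fnum y - fnum x * fden y == 1.

Definition farey_sum (x y : xrat) : rat :=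
  (fnum x + fnum y)%:~R / (fden x + fden y)%:~R.

(* The ancestor triangle of alpha. Indices are shifted by one: the vertices of
   the (i+1)-st fundamental triangle are (top alpha i).1 (upper left),
   (top alpha i).2 (upper right) and bot alpha i (bottom). Only the indices
   i < ntri alpha are meaningful. *)
Definition top_step (alpha : rat) (yz : xrat * xrat) : xrat * xrat :=
  let m := farey_sum yz.1 yz.2 in
  if m < alpha then (Some m, yz.2) else (yz.1, Some m).

Definition top (alpha : rat) (i : nat) : xrat * xrat :=
  iter i (top_step alpha) (Some 0, None).

Definition bot (alpha : rat) (i : nat) : rat :=
  farey_sum (top alpha i).1 (top alpha i).2.

(* The least N >= 1 such that m_N = alpha; the search bound is large enough for
   every alpha > 0 (bot_ntri). *)
Definition ntri (alpha : rat) : nat :=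
  (find (fun i => bot alpha i == alpha)
        (iota 0 `|(numq alpha + denq alpha)%R|)).+1.

Definition left_side (alpha : rat) : seq xrat :=
  rcons (undup [seq (top alpha i).1 | i <- iota 0 (ntri alpha)]) (Some alpha).

Definition right_side (alpha : rat) : seq xrat :=
  rcons (undup [seq (top alpha i).2 | i <- iota 0 (ntri alpha)]) (Some alpha).

Definition lnum (alpha : rat) : nat := (size (left_side alpha)).-1.
Definition rnum (alpha : rat) : nat := (size (right_side alpha)).-1.

(* u is a parent of v, for u and v vertices of the ancestor triangle of alpha:
   the parents of m_i are y_i and z_i, as these are Farey neighbors
   (top_neighbors), while 0 and oo have no parents. *)
Definition parent_in (alpha : rat) (u v : xrat) : bool :=
  [exists i : 'I_(ntri alpha),
    (v == Some (bot alpha i)) && (u \in [:: (top alpha i).1; (top alpha i).2])].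

(* A descending path is given by its sequence of vertices, ends included. *)
Definition desc_paths (s : xrat) (alpha : rat) : set (seq xrat) :=
  [set g | [/\ ohead g = Some s, last s g = Some alpha
             & sorted (parent_in alpha) g]]%classic.

Definition on_path (g : seq xrat) (u v : xrat) : bool :=
  infix [:: u; v] g || infix [:: v; u] g.

(* Consecutive fundamental triangles share an edge; two of them are in the same
   piece of the ancestor triangle cut along g when they can be joined without
   crossing an edge of g. *)
Definition glued (alpha : rat) (g : seq xrat) : rel 'I_(ntri alpha) :=
  fun i j =>
    ((j == i.+1 :> nat) && ~~ on_path g (top alpha j).1 (top alpha j).2)
 || ((i == j.+1 :> nat) && ~~ on_path g (top alpha i).1 (top alpha i).2).

Definition borders (alpha : rat) (g side : seq xrat) (i : 'I_(ntri alpha)) : bool :=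
  let T := [:: (top alpha i).1; (top alpha i).2; Some (bot alpha i)] in
  has (fun e => [&& e.1 \in T, e.2 \in T & ~~ on_path g e.1 e.2])
      (zip side (behead side)).

(* The triangles on the left (right) of g are those in a piece having on its
   border an edge of the left (right) oblique side not belonging to g. The top
   edge 0--oo can be ignored: for g starting at 0 (at oo) the piece containing
   it also borders the right (left) oblique side at the other top corner. *)
Definition cut_count (alpha : rat) (g side : seq xrat) : nat :=
  #|[set i : 'I_(ntri alpha) |
      [exists j, connect (@glued alpha g) i j && @borders alpha g side j]]|.

Definition wL (alpha : rat) (g : seq xrat) : nat :=
  cut_count alpha g (left_side alpha).
Definition wR (alpha : rat) (g : seq xrat) : nat :=
  cut_count alpha g (right_side alpha).

(* Meaningful on oo and the non-negative rationals. *)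
Definition phi (x : xrat) : laurent * laurent :=
  match x with
  | None => (A ^ 6, 0)
  | Some alpha =>
    if alpha == 0 then (0, 1) else
    (A ^ 6 * (- A ^ 4) ^ (- (rnum alpha)%:Z) *
       \sum_(g \in desc_paths None alpha) (- A ^ 4) ^ (wR alpha g)%:Z,
     (- A ^ 4) ^ (lnum alpha)%:Z *
       \sum_(g \in desc_paths (Some 0) alpha) (- A ^ 4) ^ (- (wL alpha g)%:Z))
  end.

Inductive letter := LetterL | LetterR.

Definition letter_to_bool (c : letter) : bool := if c is LetterL then true else false.
Definition letter_of_bool (b : bool) : letter := if b then LetterL else LetterR.
Fact letter_to_boolK : cancel letter_to_bool letter_of_bool.
Proof. by case. Qed.
HB.instance Definition _ := Countable.copy letter (can_type letter_to_boolK).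

(* A vertex of the Stern-Brocot tree is encoded by its pair of parents. *)
Definition sb_child (yz : xrat * xrat) (c : letter) : xrat * xrat :=
  let a := farey_sum yz.1 yz.2 in
  if c is LetterL then (yz.1, Some a) else (Some a, yz.2).

Definition sb_vertex (path : seq letter) : xrat * xrat :=
  foldl sb_child (Some 0, Some 1) path.

(* The rational alpha such that w(alpha) = w; w lists the last step first. *)
Definition rat_of_word (w : seq letter) : rat :=
  let yz := sb_vertex (rev w) in farey_sum yz.1 yz.2.

Definition bracket (w : seq letter) : laurent := v (phi (Some (rat_of_word w))).

Lemma farey_sumE (x y : xrat) :
  farey_neighbors x y -> 0 <= fden x -> 0 <= fden y ->
  fnum (Some (farey_sum x y)) = fnum x + fnum y /\
  fden (Some (farey_sum x y)) = fden x + fden y.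
Proof.
rewrite /farey_neighbors => /eqP xy dx dy.
have d_gt0 : 0 < fden x + fden y.
  rewrite lt0r addr_ge0 // andbT; apply/eqP => s0.
  have [x0 y0] : fden x = 0 /\ fden y = 0 by lia.
  by move: xy; rewrite x0 y0 mul0r mulr0.
have co : coprime `|fnum x + fnum y| `|fden x + fden y|.
  suff : coprimez (fnum x + fnum y) (fden x + fden y) by [].
  apply/coprimezP; exists (fden x, - fnum x) => /=.
  by rewrite mulrDr mulNr mulrDr opprD addrACA [fnum x * _]mulrC subrr add0r.
rewrite /farey_sum /= coprimeq_num // coprimeq_den //.
by rewrite gtr0_sg // mul1r gtr0_norm // gt_eqF.
Qed.

Definition top_inv (x y : xrat) : Prop :=
  [/\ farey_neighbors x y, 0 <= fden x, 0 <= fden y, 0 <= fnum x & 0 <= fnum y].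

Lemma top_inv_sum (x y : xrat) : top_inv x y ->
  top_inv x (Some (farey_sum x y)) /\ top_inv (Some (farey_sum x y)) y.
Proof.
move=> [xy dx dy nx ny]; have [nm dm] := farey_sumE xy dx dy.
split; split=> //; rewrite ?nm ?dm ?addr_ge0 //;
  move: xy; rewrite /farey_neighbors nm dm => /eqP <-; apply/eqP; lia.
Qed.

Lemma top_invP alpha i : top_inv (top alpha i).1 (top alpha i).2.
Proof.
elim: i => [|i /top_inv_sum[IHl IHr]] //=.
by rewrite /top_step; case: ifP.
Qed.

Lemma top_neighbors alpha i : farey_neighbors (top alpha i).1 (top alpha i).2.
Proof. by case: (top_invP alpha i). Qed.

Lemma bot_ntri (alpha : rat) : 0 < alpha -> bot alpha (ntri alpha).-1 = alpha.
Proof.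
move=> a0; rewrite /ntri /=; set P := fun i => _; set s := iota _ _.
have [hs|hn] := boolP (has P s).
  move: (hs) (nth_find 0%N hs).
    by rewrite has_find size_iota => hf /eqP; rewrite nth_iota.
exfalso; have d0 := denq_gt0 alpha; have n0 : 0 < numq alpha by rewrite numq_gt0.
suff H i : (i <= `|(numq alpha + denq alpha)%R|)%N ->
    [/\ numq alpha * fden (top alpha i).1 > fnum (top alpha i).1 * denq alpha,
        fnum (top alpha i).2 * denq alpha > numq alpha * fden (top alpha i).2
      & i.+2%:Z <= fnum (top alpha i).1 + fden (top alpha i).1 +
                   (fnum (top alpha i).2 + fden (top alpha i).2)].
  have [h1 h2 h3] := H _ (leqnn _).
  have [/eqP xy dx dy nx ny] := top_invP alpha `|(numq alpha + denq alpha)%R|.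
  move: h1 h2 h3 xy dx dy nx ny.
  set k := `|_|%N; have hk : k%:Z = numq alpha + denq alpha by lia.
  move: hk; move: k (numq alpha) (denq alpha) d0 n0 => k p q d0 n0.
  set ny := fnum _; set nz := fnum _; set dy := fden _; set dz := fden _.
  move=> hk h1 h2 h3 xy dy0 dz0 ny0 nz0.
  have e : p + q = (ny + dy) * (nz * q - p * dz) + (nz + dz) * (p * dy - ny * q).
    rewrite -[LHS]mulr1 -xy; lia.
  nia.
elim: i => [|i IH] ile; first by rewrite /= !mul0r !mul1r !mulr1 !mulr0.
have [h1 h2 h3] := IH (ltnW ile).
have [xy dx dy nx ny] := top_invP alpha i.
have [nm dm] := farey_sumE xy dx dy.
have neq : bot alpha i != alpha.
  apply: contra hn => e; apply/hasP; exists i => //.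
  by rewrite mem_iota add0n.
have cmp : (farey_sum (top alpha i).1 (top alpha i).2 < alpha) =
   ((fnum (top alpha i).1 + fnum (top alpha i).2) * denq alpha
     < numq alpha * (fden (top alpha i).1 + fden (top alpha i).2)).
  by rewrite -nm -dm; apply: lt_ratE.
have cmp' : (farey_sum (top alpha i).1 (top alpha i).2 == alpha) = false.
  exact: negbTE.
have gt : (farey_sum (top alpha i).1 (top alpha i).2 < alpha) = false ->
   numq alpha * (fden (top alpha i).1 + fden (top alpha i).2) <
   (fnum (top alpha i).1 + fnum (top alpha i).2) * denq alpha.
  move/negbT; rewrite -leNgt le_eqVlt eq_sym cmp' /= -nm -dm => h.
  by move: h; rewrite -[X in is_true X -> _]/(lt_rat _ _) lt_ratE.
have dy0 : 1 <= fnum (top alpha i).1 + fden (top alpha i).1.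
  move: xy dx nx; rewrite /farey_neighbors => /eqP; nia.
have dz0 : 1 <= fnum (top alpha i).2 + fden (top alpha i).2.
  move: xy dy ny; rewrite /farey_neighbors => /eqP; nia.
have topS : top alpha i.+1 = top_step alpha (top alpha i) by [].
rewrite topS /top_step; case: ifP => [|/gt] h; [rewrite cmp in h|];
  cbn [fst snd]; rewrite ?nm ?dm; split => //. all: lia.
Qed.

Lemma parent_in_height alpha u v :
  parent_in alpha u v -> fnum u + fden u < fnum v + fden v.
Proof.
case/existsP => i /andP[/eqP -> ui].
have [xy dx dy nx ny] := top_invP alpha i.
have [nm dm] := farey_sumE xy dx dy; rewrite /bot nm dm.
have y_ge1 : 1 <= fnum (top alpha i).1 + fden (top alpha i).1.
  move: xy dx nx; rewrite /farey_neighbors => /eqP; nia.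
have z_ge1 : 1 <= fnum (top alpha i).2 + fden (top alpha i).2.
  move: xy dy ny; rewrite /farey_neighbors => /eqP; nia.
by move: ui; rewrite !inE => /orP[] /eqP ->; lia.
Qed.

Lemma finite_desc_paths (s : xrat) alpha : finite_set (desc_paths s alpha).
Proof.
have [bs bsP] : exists bs : seq xrat,
    forall i : 'I_(ntri alpha), Some (bot alpha i) \in bs.
  exists [seq Some (bot alpha i) | i <- iota 0 (ntri alpha)] => i.
  by apply: (map_f (fun j => Some (bot alpha j))); rewrite mem_iota add0n ltn_ord.
pose vs := s :: bs.
pose fix seqs n := if n is n'.+1
  then [::] :: [seq x :: g | x <- vs, g <- seqs n'] else [:: [::]].
have seqsP n (g : seq xrat) :
    (size g <= n)%N -> {subset g <= vs} -> g \in seqs n.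
  elim: n g => [|n IH] [|x g] // gn gs.
  rewrite in_cons; apply/orP; right; apply/allpairsP; exists (x, g).
  split => //=.
    by apply: gs; rewrite inE eqxx.
  by apply: IH => // y yg; apply: gs; rewrite inE yg orbT.
apply: (@sub_finite_set _ _ [set` seqs (size vs)]); last exact: finite_seq.
move=> [|x p] [hd _ sp] //; case: hd sp => -> {x} sp.
have pvs : {subset s :: p <= vs}.
  move=> y; rewrite !in_cons => /orP[-> //|yp]; apply/orP; right.
  elim: p s sp yp {vs seqs seqsP} => // z p IH s'.
  move=> /andP[/existsP[i /andP[/eqP ez _]] zp].
  by rewrite inE => /orP[/eqP ->|]; [rewrite ez; apply: bsP | exact: IH zp].
apply: (seqsP _ (s :: p)) => //; apply: uniq_leq_size => //.
pose h (u : xrat) := fnum u + fden u.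
apply: (@sorted_uniq _ (fun u v => h u < h v)).
- by move=> a b c; apply: lt_trans.
- by move=> a; rewrite ltxx.
- by apply: sub_path sp => a b; apply: parent_in_height.
Qed.

Lemma rat_of_word_itv (w : seq letter) : 0 < rat_of_word w < 1.
Proof.
rewrite /rat_of_word /sb_vertex.
have : [/\ top_inv (Some 0) (Some 1), 0 < fden (Some 0), 0 < fden (Some 1)
        & fnum (Some 1) <= fden (Some 1)] by [].
elim: (rev w) (Some 0) (Some 1) => [|c s IH] y z [[xy dx dy nx ny] dy0 dz0 zd] /=.
  have [nm dm] := farey_sumE xy dx dy.
  have nm' : 0 < fnum y + fnum z < fden y + fden z.
    by move: xy; rewrite /farey_neighbors => /eqP; nia.
  move: nm'; rewrite -nm -dm /= => /andP[h1 h2]; rewrite -numq_gt0 h1 /=.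
  by rewrite -[X in is_true X]/(lt_rat _ _) lt_ratE mulr1 mul1r.
have [nm dm] := farey_sumE xy dx dy.
have m1 : fnum (Some (farey_sum y z)) <= fden (Some (farey_sum y z)).
  by rewrite nm dm; move: xy; rewrite /farey_neighbors => /eqP; nia.
have m2 : 0 < fden (Some (farey_sum y z)) by rewrite dm addr_gt0.
by case: c; apply: IH; split=> //; case: (top_inv_sum (And5 xy dx dy nx ny)).
Qed.

(* Main.v *)
Require Import Defs.
From mathcomp Require Import all_boot all_order all_algebra.
From mathcomp Require Import classical_sets fsbigop.
From mathcomp Require Import zify ring.
Import Order.TTheory GRing.Theory Num.Theory.
Local Open Scope ring_scope.

(** Write q = -A^4. The idea is that phi, although defined by sums over paths,
    satisfies a weighted version of the Farey recursion:
    phi(y # z) = q phi(y) + q^-1 phi(z).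
    A descending path to y # z reaches it from y or from z, and the number of
    triangles on a given side of the path is governed by that last step; the
    powers q^-r(alpha) and q^l(alpha) are exactly what turns the resulting
    recursion into one whose coefficients do not depend on alpha
    ([path_sum], [v_phi]).

    Applying v gives values f(0) = 1, f(oo) = A^6 delta and
    f(y # z) = q f(y) + q^-1 f(z), whence f(1) = 1 ([weighted_farey_1]). Hence,
    from the pair (0, 1) downwards, every value is a Laurent polynomial in q
    with non-negative coefficients: this is the sign statement, and it rules
    out cancellation when degrees are computed. If the degrees in q of the
    values at parents (y, z) range over [ly, hy] and [lz, hz], with
    lz <= ly + 2 and hz <= hy + 2, then those at y # z range over
    [lz - 1, hy + 1], and the two inequalities persist at both children. An L
    step replaces z and so lowers lz by one, an R step replaces y and so raises
    hy by one, which yields the two degrees ([bracket_descend]).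

    The recursion needs the sides of a path in a form that is local in the
    triangle. The combinatorial key is that a path leaves the part of the
    ancestor triangle above the edge y_i z_i at exactly one vertex [exit],
    which is y_i or z_i ([exit_corner]), and that the i-th triangle lies on
    the left of the path if this vertex is z_i and on the right if it is y_i
    ([cut_countE]). Left and right are treated together: a boolean names a
    side, [true] for left. *)

Set Implicit Arguments.
Unset Strict Implicit.
Unset Printing Implicit Defensive.

Lemma cat_first_inj (T : eqType) (x : T) p1 q1 p2 q2 :
  x \notin p1 -> x \notin p2 -> p1 ++ x :: q1 = p2 ++ x :: q2 -> p1 = p2.
Proof.
elim: p1 p2 => [|y p1 IH] [|z p2] //=.
- by move=> _ + [e]; rewrite e inE eqxx.
- by move=> + _ [e]; rewrite e inE eqxx.
by rewrite !inE => /norP[_ n1] /norP[_ n2] [-> /(IH _ n1 n2) ->].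
Qed.

Lemma zip_behead_rcons (T : Type) (x y : T) (l : seq T) :
  zip (rcons (rcons l x) y) (behead (rcons (rcons l x) y)) =
  rcons (zip (rcons l x) (behead (rcons l x))) (x, y).
Proof. by elim: l => [|z [|z' l]] //= [->]. Qed.

(** * Vertices of the ancestor triangle *)

Section AncestorTriangle.
Variable alpha : rat.

Definition corner (c : bool) (i : nat) : xrat :=
  if c then (top alpha i).1 else (top alpha i).2.

Definition apex (i : nat) : xrat := Some (bot alpha i).

(** Which of the two upper corners the i-th apex replaces in the next triangle:
    the left one when alpha lies to the right of the apex. *)
Definition turn (i : nat) : bool := bot alpha i < alpha.

Lemma cornerS c i : corner c i.+1 = if c == turn i then apex i else corner c i.
Proof.
have topS : top alpha i.+1 = top_step alpha (top alpha i) by [].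
by rewrite /corner /turn /apex topS /top_step /bot; case: c; case: (_ < alpha).
Qed.

Lemma corner_turn i : corner (turn i) i.+1 = apex i.
Proof. by rewrite cornerS eqxx. Qed.

Lemma corner_keep i : corner (~~ turn i) i.+1 = corner (~~ turn i) i.
Proof. by rewrite cornerS; case: turn. Qed.

(** Heights add up under Farey sums, so they increase strictly along descending
    paths and along the sequence of apexes; this is what separates vertices. *)
Definition height (u : xrat) : int := fnum u + fden u.

Lemma height_apex i :
  height (apex i) = height (corner true i) + height (corner false i).
Proof.
have [xy dx dy nx ny] := top_invP alpha i.
by have [] := farey_sumE xy dx dy; rewrite /height /apex /bot /corner => -> ->; ring.
Qed.

Lemma height_corner_gt0 c i : 0 < height (corner c i).
Proof.
have [+ dx dy nx ny] := top_invP alpha i; rewrite /farey_neighbors => /eqP.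
by rewrite /height /corner; case: c; nia.
Qed.

Lemma height_corner_apex c i : height (corner c i) < height (apex i).
Proof.
rewrite height_apex; have := height_corner_gt0 true i.
by have := height_corner_gt0 false i; case: c; lia.
Qed.

Lemma height_corner_le c i j :
  (i <= j)%N -> height (corner c i) <= height (corner c j).
Proof.
elim: j => [|j IH]; first by rewrite leqn0 => /eqP ->.
rewrite leq_eqVlt => /orP[/eqP -> //|]; rewrite ltnS => /IH /le_trans; apply.
by rewrite cornerS; case: ifP => // _; apply/ltW/height_corner_apex.
Qed.

Lemma height_corner_lt c i j :
  (i <= j)%N -> height (corner c i) < height (apex j).
Proof.
by move=> /(height_corner_le c) /le_lt_trans; apply; apply: height_corner_apex.
Qed.

Lemma height_apex_lt i j : (i < j)%N -> height (apex i) < height (apex j).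
Proof. by rewrite -corner_turn; apply: height_corner_lt. Qed.

Lemma apex_inj : injective apex.
Proof.
move=> i j e; case: (ltngtP i j) => // /height_apex_lt; by rewrite e ltxx.
Qed.

Lemma corner_neq_apex c i j : (i <= j)%N -> corner c i != apex j.
Proof. by move=> /(height_corner_lt c); apply: contraTneq => ->; rewrite ltxx. Qed.

Lemma parent_inP u w : parent_in alpha u w ->
  exists2 i, (i < ntri alpha)%N & w = apex i /\ exists c, u = corner c i.
Proof.
case/existsP => i /andP[/eqP -> ui]; exists i => //; split=> //.
by move: ui; rewrite !inE => /orP[] /eqP ->; [exists true | exists false].
Qed.

Lemma parent_in_apex u i : parent_in alpha u (apex i) -> exists c, u = corner c i.
Proof. by case/parent_inP => j _ [/apex_inj -> []] c ->; exists c. Qed.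

Lemma parent_in_corner c i : (i < ntri alpha)%N -> parent_in alpha (corner c i) (apex i).
Proof.
move=> iN; apply/existsP; exists (Ordinal iN).
by rewrite eqxx /corner !inE /=; case: c; rewrite eqxx ?orbT.
Qed.

(** * Descending paths and where they leave the upper part *)

Definition apexes (g : seq xrat) (n : nat) : seq xrat :=
  [seq apex k | k <- iota 0 n & apex k \in g].

Lemma apexesS g n : apexes g n.+1 =
  if apex n \in g then rcons (apexes g n) (apex n) else apexes g n.
Proof.
rewrite /apexes -addn1 iotaD add0n cats1 filter_rcons.
by case: ifP => //; rewrite map_rcons.
Qed.

Lemma apexesP g n u :
  reflect (exists2 k, (k < n)%N & u = apex k /\ apex k \in g) (u \in apexes g n).
Proof.
apply: (iffP mapP) => [[k]|[k kn [-> kg]]].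
  by rewrite mem_filter mem_iota add0n => /andP[kg kn] ->; exists k.
by exists k; rewrite // mem_filter kg mem_iota.
Qed.

Lemma apexes_split g n i : (i < n)%N -> apex i \in g ->
  exists q, apexes g n = apexes g i ++ apex i :: q.
Proof.
move=> /subnKC <- ig; rewrite /apexes addSnnS iotaD filter_cat map_cat /= add0n ig.
by eexists.
Qed.

Section Paths.
Variable c0 : bool.
Let s := corner c0 0.

(** The last vertex of [g] before it goes on to apexes of index at least i. *)
Definition exit (g : seq xrat) (i : nat) : xrat := last s (apexes g i).

Lemma exitS g i : exit g i.+1 = if apex i \in g then apex i else exit g i.
Proof. by rewrite /exit apexesS; case: ifP => // _; rewrite last_rcons. Qed.

Lemma exit_neq_apex g i k : (i <= k)%N -> exit g i != apex k.
Proof.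
move=> ik; rewrite /exit; have := mem_last s (apexes g i).
rewrite inE => /orP[/eqP ->|]; first exact: corner_neq_apex.
case/apexesP => j ji [-> _]; apply: contraTneq (leq_trans ji ik) => /apex_inj ->.
by rewrite ltnn.
Qed.

Definition is_path (u : xrat) (g : seq xrat) : Prop :=
  [/\ ohead g = Some s, last s g = u & sorted (parent_in alpha) g].

Lemma is_path_height u g :
  is_path u g -> sorted (relpre height (<%R : rel int)) g.
Proof. by case=> _ _; apply: sub_sorted => x y; apply: parent_in_height. Qed.

Lemma is_path_uniq u g : is_path u g -> uniq g.
Proof.
move=> /is_path_height; apply: sorted_uniq.
- by move=> a b c; apply: lt_trans.
- by move=> a; apply: ltxx.
Qed.

(** Both sequences are sorted by height and have the same members: apart from
    its start, a path visits apexes only, in their order. *)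
Lemma is_pathE u g : is_path u g -> g = s :: apexes g (ntri alpha).
Proof.
move=> gP; have gh := is_path_height gP; have gu := is_path_uniq gP.
case: g gP gh gu => [|x p] [hd _ sp] //; case: hd sp => -> sp gh gu.
apply: (irr_sorted_eq _ _ gh).
- by move=> a b c; apply: lt_trans.
- by move=> a; apply: ltxx.
- rewrite /= path_sortedE; last by move=> a b c; apply: lt_trans.
  apply/andP; split; first by apply/allP => v /apexesP[k _ [-> _]]; apply: height_corner_lt.
  rewrite sorted_map; apply: sorted_filter; first by move=> a b c; apply: lt_trans.
  by apply: sub_sorted (iota_ltn_sorted _ _) => a b; apply: height_apex_lt.
- move=> v; rewrite !inE; case: eqP => //= vs; apply/idP/idP => [vp|].
    suff [k kN vk] : exists2 k, (k < ntri alpha)%N & v = apex k.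
      by apply/apexesP; exists k; rewrite // -vk inE vp orbT.
    move: vp sp; clear; elim: p (s) => // y p IH x' + /= /andP[/parent_inP[k kN [yk _]] yp].
    by rewrite inE => /orP[/eqP ->|vp]; [exists k | exact: IH vp yp].
  case/apexesP => k _ [->]; rewrite inE => /orP[|//].
  by rewrite eq_sym (negbTE (corner_neq_apex _ _)).
Qed.

Lemma path_split u g i : is_path u g -> (i < ntri alpha)%N -> apex i \in g ->
  exists q, g = (s :: apexes g i) ++ apex i :: q.
Proof.
move=> gP iN ig; have [q e] := apexes_split iN ig; exists q.
by rewrite {1}(is_pathE gP) e.
Qed.

Lemma infix_height u g x y : is_path u g -> infix [:: x; y] g -> height x < height y.
Proof.
move=> /is_path_height + /infixP[p [q e]]; rewrite e.
by move=> /cat_sorted2[_] /= /andP[].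
Qed.


(** A path visits each vertex once, so an edge into an apex is on it exactly
    when the path comes to this apex from there. *)
Lemma infix_exit u g i x : is_path u g -> (i < ntri alpha)%N ->
  infix [:: x; apex i] g = (apex i \in g) && (exit g i == x).
Proof.
move=> gP iN; have [ig|] := boolP (apex i \in g); last first.
  by apply: contraNF => /infixP[p [q ->]]; rewrite mem_cat !inE eqxx !orbT.
have gu := is_path_uniq gP; have [q gE] := path_split gP iN ig.
apply/infixP/eqP => /= [[p [q' e]]|<-].
  move: gu (gu) (e); rewrite {1}e {1 2}gE -cat_rcons !cat_uniq /=.
  move=> /and3P[_ /norP[ip _] _] /and3P[_ /norP[ip' _] _] /(cat_first_inj ip' ip) e'.
  by rewrite /exit -(last_cons s) e' last_rcons.
exists (belast s (apexes g i)), q.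
rewrite -[[:: _, _ & q]]/([:: _] ++ apex i :: q) catA cats1 -lastI.
exact: gE.
Qed.

End Paths.

Section FullPaths.
Hypothesis alpha_gt0 : 0 < alpha.
Let N := ntri alpha.

Lemma apex_last : apex N.-1 = Some alpha.
Proof. by rewrite /apex bot_ntri. Qed.

(** Left corners lie strictly below alpha, right corners do not. *)
Lemma corner_neq i j : corner true i != corner false j.
Proof.
pose below u := if u is Some r then r < alpha else false.
have belowP c k : below (corner c k) = c.
  elim: k => [|k IH]; first by case: c.
  by rewrite cornerS; case: eqP => // ->.
by apply: contra_eq_neq (belowP true i) => ->; rewrite belowP.
Qed.

Lemma corner_negb c i j : corner c i != corner (~~ c) j.
Proof. by case: c; rewrite ?(eq_sym (corner false _)) corner_neq. Qed.

Lemma corner_eq c d i : (corner c i == corner d i) = (c == d).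
Proof.
case: c; case: d; rewrite ?eqxx // ?(negbTE (corner_neq _ _)) //.
by rewrite eq_sym (negbTE (corner_neq _ _)).
Qed.

(** * Counting the triangles on one side of a path *)

Definition chain (b : bool) (n : nat) : seq xrat :=
  undup [seq corner b i | i <- iota 0 n.+1].

Lemma chain_edges b n x :
  zip (rcons (chain b n) x) (behead (rcons (chain b n) x)) =
  rcons (zip (chain b n) (behead (chain b n))) (corner b n, x).
Proof.
rewrite /chain -addn1 iotaD cats1 map_rcons undup_rcons add0n.
exact: zip_behead_rcons.
Qed.

Lemma chainS b n :
  chain b n.+1 = if b == turn n then rcons (chain b n) (apex n) else chain b n.
Proof.
rewrite /chain -(addn1 n.+1) iotaD cats1 map_rcons add0n cornerS; case: ifP => bn.
  rewrite undup_rcons (_ : filter _ _ = undup [seq corner b i | i <- iota 0 n.+1]) //.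
  apply/all_filterP/allP => u; rewrite mem_undup => /mapP[i].
  by rewrite mem_iota ltnS => /andP[_ le_in] ->; apply: corner_neq_apex.
rewrite -addn1 iotaD cats1 map_rcons add0n !undup_rcons filter_rcons eqxx.
by rewrite filter_id.
Qed.

Definition side (b : bool) : seq xrat := rcons (chain b N.-1) (apex N.-1).

Lemma side_left : left_side alpha = side true.
Proof. by rewrite /side apex_last. Qed.

Lemma side_right : right_side alpha = side false.
Proof. by rewrite /side apex_last. Qed.

Lemma chain_edgeP b n (e : xrat * xrat) :
  reflect (exists2 i, (i < n)%N & b == turn i /\ e = (corner b i, apex i))
          (e \in zip (chain b n) (behead (chain b n))).
Proof.
elim: n => [|n IH]; first by apply: (iffP idP) => [|[]].
rewrite chainS; case: ifP => bn; last first.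
  apply: (iffP IH) => -[i i_n [bi ->]]; first by exists i; rewrite // ltnW.
  exists i => //; move: i_n; rewrite ltnS leq_eqVlt => /orP[/eqP i_n|//].
  by rewrite i_n bn in bi.
rewrite chain_edges mem_rcons inE; apply: (iffP orP).
  case=> [/eqP ->|/IH[i i_n [bi ->]]]; first by exists n.
  by exists i; rewrite // ltnW.
case=> i; rewrite ltnS leq_eqVlt => /orP[/eqP -> [_ ->]|i_n biE].
  by left.
by right; apply/IH; exists i.
Qed.

Lemma side_edgeP b (e : xrat * xrat) :
  reflect (exists2 i, (i < N)%N &
             ((i == N.-1) || (b == turn i)) /\ e = (corner b i, apex i))
          (e \in zip (side b) (behead (side b))).
Proof.
rewrite /side chain_edges mem_rcons inE; apply: (iffP orP).
  case=> [/eqP ->|/chain_edgeP[i iN [bi ->]]]; first by exists N.-1; rewrite ?eqxx.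
  by exists i; [apply: ltn_trans iN _ | rewrite bi orbT].
case=> i iN [/orP[/eqP -> ->|bi ei]]; first by left.
move: iN; rewrite -[N]/(N.-1.+1) ltnS leq_eqVlt => /orP[/eqP iN1|iN].
  by left; rewrite ei iN1.
by right; apply/chain_edgeP; exists i.
Qed.

Variables (c0 : bool) (g : seq xrat).
Hypothesis gP : is_path c0 (Some alpha) g.

Lemma last_apex_in : apex N.-1 \in g.
Proof.
case: gP; case: (g) => // x p _ + _; rewrite apex_last /= => <-.
exact: mem_last.
Qed.

Lemma exit_path_corner i : (i < N)%N -> apex i \in g -> exists c, exit c0 g i = corner c i.
Proof.
move=> iN ig; have [q e] := path_split gP iN ig.
case: gP => _ _; rewrite {1}e /= cat_path /= => /and3P[_ + _].
exact: parent_in_apex.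
Qed.

(** Downward induction on i. At a visited apex the vertex before it is one of
    its parents. At an apex that is skipped, the exit vertex is the same as for
    the next triangle, hence a corner there; being no apex of index i, it is
    the corner that both triangles share. *)
Lemma exit_corner i : (i < N)%N -> exists c, exit c0 g i = corner c i.
Proof.
move=> iN; rewrite -(subKn (ltnSE iN : i <= N.-1)%N).
have : (N.-1 - i <= N.-1)%N by apply: leq_subr.
elim: (N.-1 - i)%N => [|k IH] kN.
  by rewrite subn0; apply: exit_path_corner last_apex_in.
have jN : (N.-1 - k.+1 < N)%N by rewrite ltnS leq_subr.
have [ig|nig] := boolP (apex (N.-1 - k.+1) \in g); first exact: exit_path_corner.
have [c] := IH (ltnW kN); rewrite -(subnSK kN) exitS (negbTE nig) => e.
move: e; rewrite cornerS; case: eqP => [_ e|_ ->]; last by exists c.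
by have /eqP[] := exit_neq_apex c0 g (leqnn (N.-1 - k.+1)).
Qed.

Lemma exit_skip i : (i.+1 < N)%N -> apex i \notin g ->
  exit c0 g i = corner (~~ turn i) i.
Proof.
move=> iN nig; have [c] := exit_corner iN; rewrite exitS (negbTE nig).
rewrite cornerS; case: eqP => [_ e|/eqP cn ->]; last by case: c cn; case: turn.
by have /eqP[] := exit_neq_apex c0 g (leqnn i).
Qed.

(** The i-th triangle is to the left of a path that leaves by its right
    corner, and to the right of one that leaves by its left corner. *)
Definition on_side (b : bool) (h : seq xrat) (i : nat) : bool :=
  exit c0 h i == corner (~~ b) i.

Lemma on_side_negb b i : (i < N)%N -> on_side (~~ b) g i = ~~ on_side b g i.
Proof.
move=> iN; rewrite /on_side; have [c ->] := exit_corner iN.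
by rewrite !corner_eq; case: b; case: c.
Qed.

Lemma on_path_apex i c : (i < N)%N ->
  on_path g (corner c i) (apex i) = (apex i \in g) && on_side (~~ c) g i.
Proof.
move=> iN; rewrite /on_path (infix_exit _ gP) // /on_side negbK.
case: (boolP (infix [:: apex i; _] g)) => [|_]; last by rewrite orbF.
move=> /(infix_height gP) /(lt_trans (height_corner_apex c i)); by rewrite ltxx.
Qed.

Lemma on_pathC (h : seq xrat) u v : on_path h u v = on_path h v u.
Proof. by rewrite /on_path orbC. Qed.

Lemma on_path_top i : (i.+1 < N)%N ->
  on_path g (top alpha i.+1).1 (top alpha i.+1).2 =
  (apex i \in g) && on_side (turn i) g i.
Proof.
move=> iN; rewrite -[(top _ _).1]/(corner true i.+1) -[(top _ _).2]/(corner false i.+1).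
rewrite -[in RHS](negbK (turn i)) -on_path_apex ?(ltnW iN) //.
by rewrite !cornerS; case: turn; rewrite //= on_pathC.
Qed.

(** Crossing an edge that is not on the path does not change sides. *)
Lemma on_side_glued b i : (i.+1 < N)%N ->
  ~~ on_path g (top alpha i.+1).1 (top alpha i.+1).2 ->
  on_side b g i = on_side b g i.+1.
Proof.
move=> iN; rewrite on_path_top //.
have [ig /=|nig _] := boolP (apex i \in g).
  rewrite -on_side_negb ?(ltnW iN) // /on_side exitS ig negbK => /eqP ->.
  by rewrite -corner_turn !corner_eq.
rewrite /on_side exitS (negbTE nig) exit_skip // -{2}corner_keep.
by rewrite !corner_eq.
Qed.

(** Among the edges of a triangle, only the one from the corner on side [b] to
    the apex can lie on the oblique side [b], for a triangle that is not the
    last one; it does so if the next triangle has this apex as its corner on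
    side [b]. In the last triangle both edges into alpha are oblique. *)
Lemma bordersE b (i : 'I_N) : borders g (side b) i =
  ((i == N.-1 :> nat) || (b == turn i)) && ~~ on_path g (corner b i) (apex i).
Proof.
apply/hasP/andP => [[ed /side_edgeP[j jN [jb ->]]]|[ib np]]; last first.
  exists (corner b i, apex i); first by apply/side_edgeP; exists i.
  apply/and3P; split => //=; rewrite !inE ?eqxx ?orbT //.
  by rewrite /corner; case: b {ib np}; rewrite eqxx ?orbT.
have inT u : u \in [:: (top alpha i).1; (top alpha i).2; Some (bot alpha i)] ->
    u = apex i \/ exists c, u = corner c i.
  rewrite !inE => /or3P[] /eqP ->; [right|right|by left].
    by exists true.
  by exists false.
case/and3P => /= /inT jT /inT [/apex_inj e|[c e]] np {ed}.
  by rewrite e in jb np.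
have i_gt_j : (j < i)%N.
  by rewrite ltnNge; apply/negP => /(corner_neq_apex c); rewrite e eqxx.
have bj : b == turn j.
  by case/orP: jb => [/eqP jN1|//]; have := ltn_ord i; move: i_gt_j; rewrite jN1 /N; lia.
have bc : c = b.
  apply/eqP; apply: contraT => bc; have := corner_negb b j.+1 i.
  by rewrite cornerS bj e (_ : ~~ b = c) ?eqxx //; case: b bc {jb np jT bj}; case: c {e}.
case: jT => [ji|[d ji]].
  by have := corner_neq_apex b (ltnW i_gt_j); rewrite ji eqxx.
have := corner_neq_apex b (leqnn j); rewrite e bc ji corner_eq => db.
have := corner_negb b j i; rewrite ji (_ : ~~ b = d) ?eqxx //.
by case: b db {bc jb np bj ji}; case: d.
Qed.

(** A triangle bordering side [b] away from the path is on that side of it, and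
    gluing preserves sides. Conversely, from a triangle on side [b] one can go
    down: either it borders the oblique side, or the next triangle keeps its
    corner on side [b] and is glued to it. *)
Lemma cut_countE b : cut_count alpha g (side b) = count (on_side b g) (iota 0 N).
Proof.
have -> : count (on_side b g) (iota 0 N) = \sum_(i < N | on_side b g i) 1.
  by rewrite -(big_mkord (on_side b g) (fun=> 1%N)) /index_iota subn0 sum1_count.
rewrite /cut_count -sum1_card; apply: eq_bigl => i.
rewrite inE; apply/existsP/idP => [[j /andP[ij]]|].
  rewrite bordersE => /andP[jb np].
  have jside : on_side b g j.
    move: np; rewrite on_path_apex // on_side_negb // negb_and negbK.
    case/orP => // nj; have jN : (j.+1 < N)%N.
      rewrite ltn_neqAle ltn_ord andbT; apply: contraNneq nj => jN.
      by rewrite (_ : j = N.-1 :> nat) ?last_apex_in // -[in RHS]jN.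
    move: jb; rewrite /on_side exit_skip // => /orP[/eqP jN1|/eqP -> //].
    by move: jN; rewrite jN1 ltnn.
  have /closed_connect cl : closed (@glued alpha g) [pred k : 'I_N | on_side b g k].
    suff H (k l : 'I_N) : (l == k.+1 :> nat) ->
        ~~ on_path g (top alpha l).1 (top alpha l).2 -> on_side b g k = on_side b g l.
      move=> k l /=; rewrite !inE => /orP[] /andP[kl npkl]; first exact: H.
      by symmetry; apply: H.
    by move=> /eqP lk; rewrite lk; apply: on_side_glued; rewrite -lk.
  by have := cl _ _ ij; rewrite !inE => ->.
have [n] := ubnP (N - i); elim: n i => // n IH i; rewrite ltnS => iN si.
have np : ~~ on_path g (corner b i) (apex i).
  by rewrite on_path_apex // on_side_negb // si andbF.
have [ib|] := boolP ((i == N.-1 :> nat) || (b == turn i)).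
  by exists i; rewrite connect0 bordersE ib.
case/norP => iN1 ib; have iN' : (i.+1 < N)%N.
  by rewrite -[N]/(N.-1.+1) ltnS ltn_neqAle iN1; apply: (ltn_ord i).
have np' : ~~ on_path g (top alpha i.+1).1 (top alpha i.+1).2.
  have tb : turn i = ~~ b by move: ib; case: (turn i); case: (b).
  by rewrite on_path_top // tb on_side_negb // si andbF.
have [||j /andP[jc jb]] := IH (Ordinal iN').
- by apply: leq_trans _ iN; rewrite /= subnSK.
- by rewrite -on_side_glued.
exists j; rewrite jb andbT; apply: connect_trans jc; apply: connect1.
by rewrite /glued /= eqxx np'.
Qed.

End FullPaths.
(** * Path sums satisfy the weighted Farey recursion *)

Section PathSums.
Hypothesis alpha_gt0 : 0 < alpha.
Let N := ntri alpha.
Variable c0 : bool.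
Let s := corner c0 0.

(** Enumeration of the paths from [s] to each of the two corners of the i-th
    triangle, by the vertex before the last one. *)
Fixpoint corner_paths (i : nat) : bool -> seq (seq xrat) :=
  if i is j.+1 then fun c => if c == turn j
    then [seq rcons g (apex j) | g <- corner_paths j true ++ corner_paths j false]
    else corner_paths j c
  else fun c => if c == c0 then [:: [:: s]] else [::].

Definition apex_paths (i : nat) : seq (seq xrat) :=
  [seq rcons g (apex i) | g <- corner_paths i true ++ corner_paths i false].

Lemma corner_pathsS i c :
  corner_paths i.+1 c = if c == turn i then apex_paths i else corner_paths i c.
Proof. by []. Qed.

Lemma is_path_rcons u g : g != [::] ->
  is_path c0 u (rcons g u) <-> exists2 x, is_path c0 x g & parent_in alpha x u.
Proof.
case: g => // y p _; rewrite /is_path /= last_rcons rcons_path; split.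
  by case=> -> _ /andP[yp pu]; exists (last y p).
by case=> x [-> <- ->] ->.
Qed.

Lemma apex_pathsP i :
    (forall c g, g \in corner_paths i c <-> is_path c0 (corner c i) g) ->
  (i < N)%N -> forall g, g \in apex_paths i <-> is_path c0 (apex i) g.
Proof.
move=> IH iN g; split.
  case/mapP => h hP ->; have [c /IH hc] : exists c, h \in corner_paths i c.
    by move: hP; rewrite mem_cat => /orP[]; [exists true | exists false].
  apply/is_path_rcons; first by case: hc; case: h {hP}.
  by exists (corner c i) => //; apply: parent_in_corner.
case/lastP: g => [[] //|h u] gP; have uE : u = apex i by case: gP => _; rewrite last_rcons.
rewrite {u}uE in gP *; have h0 : h != [::].
  apply: contraTneq isT => h0; move: gP; rewrite h0 => -[[si] _ _].
  by have := corner_neq_apex c0 (leq0n i); rewrite -/s si eqxx.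
have /(is_path_rcons _ h0)[x xP /parent_in_apex[c xc]] := gP.
apply: map_f; rewrite mem_cat; move: xP; rewrite xc => /IH.
by case: c {xc} => ->; rewrite ?orbT.
Qed.

Lemma corner_pathsP i c g : (i <= N)%N ->
  g \in corner_paths i c <-> is_path c0 (corner c i) g.
Proof.
elim: i c g => [|i IH] c g iN; last first.
  rewrite corner_pathsS cornerS; case: ifP => _; last exact: IH (ltnW iN).
  by apply: apex_pathsP => // d h; apply: IH; apply: ltnW.
split=> [|gP].
  by rewrite /=; case: eqP => // ->; rewrite inE => /eqP ->.
case/lastP: g gP => [[] //|h u] gP; have uE : u = corner c 0 by case: gP => _; rewrite last_rcons.
rewrite {u}uE in gP *.
have [h0|h0] := eqVneq h [::].
  move: gP; rewrite h0 /= => -[[/eqP]]; rewrite corner_eq // => /eqP -> _ _.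
  by rewrite eqxx inE.
have /(is_path_rcons _ h0)[x _ /parent_inP[k _ [ck _]]] := gP.
by have := corner_neq_apex c (leq0n k); rewrite ck eqxx.
Qed.

Lemma desc_pathsE : desc_paths s alpha = [set` apex_paths N.-1]%classic.
Proof.
apply/seteqP; split=> g /=.
  move=> gP; apply/apex_pathsP => // [c h|]; first by apply: corner_pathsP.
  by rewrite apex_last.
case/apex_pathsP => // [c h|g0 + gs]; first by apply: corner_pathsP.
by rewrite apex_last.
Qed.

Lemma corner_paths_uniq i c : (i <= N)%N -> uniq (corner_paths i c).
Proof.
elim: i c => [|i IH] c iN; first by rewrite /=; case: ifP.
rewrite corner_pathsS; case: ifP => _; last exact: IH (ltnW iN).
rewrite map_inj_uniq; last exact: rcons_injl.
rewrite cat_uniq !IH ?(ltnW iN) //= andbT; apply/hasPn => g.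
move=> /(corner_pathsP _ _ (ltnW iN))[_ gl _]; apply/negP.
move=> /(corner_pathsP _ _ (ltnW iN))[_ gl' _].
by have := corner_neq alpha_gt0 i i; rewrite -gl -gl' eqxx.
Qed.

Lemma apex_paths_uniq i : (i < N)%N -> uniq (apex_paths i).
Proof. by move=> /(corner_paths_uniq (turn i)); rewrite corner_pathsS eqxx. Qed.

Lemma is_path_height_le u g x : is_path c0 u g -> x \in g -> height x <= height u.
Proof.
move=> gP xg; have gh := is_path_height gP; case: gP => _ gl _.
case/splitPr: xg gl gh => p q; rewrite last_cat /= => <-.
move=> /cat_sorted2[_] /=; case/lastP: q => [|q y] //=.
rewrite path_sortedE; last by move=> a b c; apply: lt_trans.
by case/andP => /allP/(_ y) + _; rewrite last_rcons mem_rcons inE eqxx => /(_ isT)/ltW.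
Qed.

Lemma corner_path_exit i c g : (i <= N)%N -> is_path c0 (corner c i) g ->
  exit c0 g i = corner c i.
Proof.
move=> iN gP; have gE := is_pathE gP; case: (gP) => _ + _.
rewrite {1}gE last_cons -/(exit c0 g N) => <-.
rewrite -(subnKC iN); elim: (N - i)%N => [|k IH]; first by rewrite addn0.
rewrite addnS exitS -IH (negbTE (_ : apex (i + k) \notin g)) //.
apply/negP => /(is_path_height_le gP) /(le_lt_trans)/(_ (height_corner_lt c (leq_addr k i))).
by rewrite ltxx.
Qed.

Definition weight (g : seq xrat) (n : nat) : nat := count (on_side c0 c0 g) (iota 0 n).

Lemma weight_corner i c g : (i <= N)%N -> is_path c0 (corner c i) g ->
  weight g i.+1 = (weight g i + (c != c0))%N.
Proof.
move=> iN gP; rewrite /weight -addn1 iotaD count_cat /= addn0 add0n; congr addn.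
by rewrite /on_side (corner_path_exit iN gP) corner_eq //; case: c {gP}; case: c0.
Qed.

Lemma weight_rcons i g : weight (rcons g (apex i)) i.+1 = weight g i.+1.
Proof.
apply: eq_in_count => j; rewrite mem_iota add0n ltnS => /andP[_ ji].
rewrite /on_side /exit; congr (last _ (map _ _) == _).
apply: eq_in_filter => k; rewrite mem_iota add0n => /andP[_ kj].
rewrite mem_rcons inE; case: eqP => // /apex_inj ki.
by have := leq_trans kj ji; rewrite ki ltnn.
Qed.

Section Values.
Variables (K : comUnitRingType) (q : K).

(** Values of the solution of the recursion f(y # z) = q f(y) + q^-1 f(z) at the
    corners of the i-th triangle, when f takes the values [x] at 0 and oo. *)
Fixpoint corner_value (x : bool -> K) (i : nat) : bool -> K :=
  if i is j.+1 then fun c => if c == turn j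
    then q * corner_value x j true + q^-1 * corner_value x j false
    else corner_value x j c
  else x.

Definition apex_value (x : bool -> K) (i : nat) : K :=
  q * corner_value x i true + q^-1 * corner_value x i false.

Lemma corner_valueS x i c :
  corner_value x i.+1 c = if c == turn i then apex_value x i else corner_value x i c.
Proof. by []. Qed.

Lemma apex_value_linear (a : K) x y z i : (forall c, z c = a * x c + y c) ->
  apex_value z i = a * apex_value x i + apex_value y i.
Proof.
move=> zE; have cornerE c : corner_value z i c = a * corner_value x i c + corner_value y i c.
  by elim: i c => [|i IH] c //=; case: ifP => _; rewrite !IH //; ring.
by rewrite /apex_value !cornerE; ring.
Qed.

Hypothesis qU : q \is a GRing.unit.
Let t := if c0 then q^-1 else q.
Let x0 (c : bool) : K := (c == c0)%:R.

(** The inductive step of [corner_sum]: extending a path from the corner on the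
    other side to the apex leaves the triangle on side [c0], which costs a
    factor t. *)
Lemma apex_sum i :
    (forall c, (\sum_(g <- corner_paths i c) t ^+ weight g i) * (if c == c0 then t else 1)
       = t ^+ size (chain c0 i) * corner_value x0 i c) ->
  (i < N)%N ->
  \sum_(g <- apex_paths i) t ^+ weight g i.+1 =
  t ^+ size (chain c0 i) * apex_value x0 i.
Proof.
move=> IH iN.
have tU : t \is a GRing.unit by rewrite /t; case: (c0); rewrite ?unitrV.
have cornerE c : \sum_(g <- corner_paths i c) t ^+ weight (rcons g (apex i)) i.+1 =
    t ^+ size (chain c0 i) * ((if c == c0 then t^-1 else t) * corner_value x0 i c).
  rewrite [RHS]mulrCA -IH; under eq_big_seq => g gc.
    rewrite weight_rcons (weight_corner (ltnW iN) ((corner_pathsP _ _ (ltnW iN)).1 gc)).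
    rewrite exprD; over.
  rewrite -mulr_suml [RHS]mulrC -[RHS]mulrA; congr (_ * _).
  by case: (c == c0); rewrite /= ?expr0 ?expr1 ?mul1r ?divrr.
rewrite big_map big_cat /= !cornerE -mulrDr; congr (_ * _).
by rewrite /apex_value /t; case: (c0); rewrite /= ?invrK.
Qed.

(** The path sums are the values of the recursion up to the factor
    t ^+ size (chain c0 i), and one factor t less at the corner on side [c0].
    When this corner moves, the power grows by one, and the paths ending at the
    opposite corner gain one triangle on side [c0]; when it stays, neither the
    power nor the count for the paths ending there changes. At the start, where
    the power is t, only paths from the corner on side [c0] fit. *)
Lemma corner_sum i c : (i <= N)%N ->
  (\sum_(g <- corner_paths i c) t ^+ weight g i) * (if c == c0 then t else 1)
    = t ^+ size (chain c0 i) * corner_value x0 i c.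
Proof.
elim: i c => [|i IH] c iN.
  rewrite /= /x0; case: ifP => cc; rewrite ?big_nil ?mul0r ?mulr0 //.
  by rewrite big_seq1 /weight /= mulr1 mul1r.
rewrite corner_pathsS corner_valueS chainS.
have IH' d := IH d (ltnW iN).
case: (eqVneq c (turn i)) => [ct|ct].
  rewrite apex_sum // ct; case: ifP; rewrite eq_sym => ->; last by rewrite mulr1.
  by rewrite size_rcons exprSr mulrAC.
under eq_big_seq => g gc.
  rewrite (weight_corner (ltnW iN) ((corner_pathsP _ _ (ltnW iN)).1 gc)) exprD; over.
rewrite -mulr_suml.
case: (eqVneq c0 (turn i)) => [c0t|c0t].
  have cc0 : (c == c0) = false by rewrite c0t (negbTE ct).
  have := IH' c; rewrite cc0 !mulr1 /= expr1 => ->.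
  by rewrite size_rcons exprSr mulrAC.
have -> : c = c0 by case: (c) ct; case: (turn i) c0t; case: (c0).
by have := IH' c0; rewrite eqxx mulr1.
Qed.

Lemma path_sum :
  \sum_(g \in desc_paths s alpha) t ^+ cut_count alpha g (side c0) =
  t ^+ size (chain c0 N.-1) * apex_value x0 N.-1.
Proof.
rewrite desc_pathsE -fsbig_seq ?apex_paths_uniq //.
rewrite -apex_sum //; last by move=> c; apply: corner_sum.
apply: eq_big_seq => g gP; congr (_ ^+ _).
have /apex_pathsP gP' : g \in apex_paths N.-1 := gP.
apply: cut_countE => //; rewrite -apex_last //; apply: gP' => // c h.
exact: corner_pathsP.
Qed.

End Values.
End PathSums.

End AncestorTriangle.

(** * Coefficients of Laurent polynomials *)

Lemma laurent_common (f g : laurent) : exists n p r,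
  \val f = laurent_frac (n, p) /\ \val g = laurent_frac (n, r).
Proof.
have [[n p] /eqP fE] := laurent_valP f; have [[m r] /eqP gE] := laurent_valP g.
exists (n + m)%N, (p * 'X^m), (r * 'X^n); rewrite fE gE /laurent_frac /=.
by split; apply/eqP; rewrite eqr_div ?tofracXn_neq0 // -!tofracM
  tofrac_eq exprD; apply/eqP; ring.
Qed.

Lemma lcoefD f g k : lcoef (f + g) k = lcoef f k + lcoef g k.
Proof.
have [n [p [r [fE gE]]]] := laurent_common f g.
have e : \val (f + g) = laurent_frac (n, p + r).
  by move: fE gE; rewrite rmorphD /= => -> ->; rewrite /laurent_frac /= -mulrDl tofracD.
rewrite (lcoefE _ e) (lcoefE _ fE) (lcoefE _ gE).
by case: (k + n%:Z) => j; rewrite ?coefD ?addr0.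
Qed.

Lemma lcoefN f k : lcoef (- f) k = - lcoef f k.
Proof.
have [[n p] /eqP fE] := laurent_valP f.
have e : \val (- f) = laurent_frac (n, - p).
  by move: fE; rewrite rmorphN /= => ->; rewrite /laurent_frac /= tofracN mulNr.
rewrite (lcoefE _ e) (lcoefE _ fE).
by case: (k + n%:Z) => j; rewrite ?coefN ?oppr0.
Qed.

Lemma lcoef1 k : lcoef 1 k = (k == 0)%:R.
Proof.
have e : \val (1 : laurent) = laurent_frac (0%N, 1).
  by rewrite rmorph1 /laurent_frac /= expr0 tofrac1 divr1.
by rewrite (lcoefE _ e) addr0; case: k => [[|k]|k] //; rewrite coef1.
Qed.

Lemma lcoef_mulA f k : lcoef (A * f) k = lcoef f (k - 1).
Proof.
have [[n p] /eqP fE] := laurent_valP f.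
have tX := tofracXn_neq0 1.
have e : \val f = laurent_frac (n.+1, 'X * p).
  rewrite fE /laurent_frac /= exprS !tofracM -mulf_div divff ?mul1r //.
have e' : \val (A * f) = laurent_frac (n, 'X * p).
  by move: fE; rewrite rmorphM /= => ->; rewrite /laurent_frac /= tofracM mulrA.
rewrite (lcoefE _ e) (lcoefE _ e'); congr (match _ with Posz _ => _ | Negz _ => _ end).
lia.
Qed.

Lemma A_unit : A \is a GRing.unit.
Proof.
have VP : laurent_frac (1%N, 1) \in laurent_pred by apply/laurent_predP; exists (1%N, 1).
apply/unitrP; suff e : Laurent VP * A = 1 by exists (Laurent VP); rewrite [A * _]mulrC.
apply: val_inj; rewrite rmorphM rmorph1 /= /laurent_frac /= tofrac1 mul1r.
by rewrite mulVf // (tofracXn_neq0 1).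
Qed.

Lemma lcoef_mulAz (z : int) f k : lcoef (A ^ z * f) k = lcoef f (k - z).
Proof.
have H n g j : lcoef (A ^+ n * g) j = lcoef g (j - n%:Z).
  elim: n j => [|n IH] j; first by rewrite expr0 mul1r subr0.
  by rewrite exprS -mulrA lcoef_mulA IH; congr lcoef; lia.
case: z => n; first exact: H.
have -> : k - Negz n = k + n.+1%:Z by rewrite NegzE opprK.
rewrite -[in LHS](addrK n.+1%:Z k) -H mulrA mulrV ?mul1r //.
by rewrite unitrX ?A_unit.
Qed.

Definition q : laurent := - A ^ 4.

Lemma q_unit : q \is a GRing.unit.
Proof. by rewrite /q unitrN unitrXz ?A_unit. Qed.

Lemma invr_oppz (K : unitRingType) (x : K) (n : int) : (- x ^ n)^-1 = - x ^ (- n).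
Proof. by rewrite invrN invr_expz. Qed.

Lemma qV : q^-1 = - A ^ (-4).
Proof. exact: invr_oppz. Qed.

Lemma lcoef_mulq f k : lcoef (q * f) k = - lcoef f (k - 4).
Proof. by rewrite /q mulNr lcoefN lcoef_mulAz. Qed.

Lemma lcoef_mulqV f k : lcoef (q^-1 * f) k = - lcoef f (k + 4).
Proof. by rewrite qV mulNr lcoefN lcoef_mulAz. Qed.

(* From here on coefficients are known through the equations above only;
   evaluating them would unfold the field of fractions. *)
Local Opaque lcoef.

(** * Signs and degrees *)

(** The coefficients of f at the powers of q = - A^4 are non-negative. *)
Definition alternating (f : laurent) : Prop :=
  forall k : int, 0 <= (-1) ^ k * lcoef f (4 * k).

(** Degrees are counted in q. *)
Definition deg_range (f : laurent) (lo hi : int) : Prop :=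
  is_mindeg f (4 * lo) /\ is_maxdeg f (4 * hi).

Lemma signz k : (-1 : int) ^ k = 1 \/ (-1 : int) ^ k = -1.
Proof.
case: k => n; rewrite /exprz -signr_odd; case: odd; rewrite ?invr1 ?invrN1 /=; by [left|right].
Qed.

Lemma signzS k : (-1 : int) ^ (k + 1) = - (-1) ^ k.
Proof. by rewrite exprzDr ?unitrN1 // mulrN1. Qed.

Lemma alternating_add f g : alternating f -> alternating g ->
  alternating (q * f + q^-1 * g).
Proof.
move=> fP gP k; rewrite lcoefD lcoef_mulq lcoef_mulqV.
have -> : 4 * k - 4 = 4 * (k - 1) by ring.
have -> : 4 * k + 4 = 4 * (k + 1) by ring.
move: (fP (k - 1)) (gP (k + 1)) (signzS (k - 1)); rewrite subrK signzS => fa + e.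
rewrite e => gb; move: fa gb; move: (lcoef f _) (lcoef g _) => a b fa gb.
have -> : - (-1) ^ (k - 1) * (- a - b) = (-1) ^ (k - 1) * a + (- - (-1) ^ (k - 1)) * b.
  by ring.
exact: addr_ge0.
Qed.

(** The bounds on lg and hf make g reach lower and f reach higher, and the two
    summands cannot cancel since they alternate in the same way. *)
Lemma deg_range_add f g lf hf lg hg : alternating f -> alternating g ->
  deg_range f lf hf -> deg_range g lg hg -> lg <= lf + 2 -> hg <= hf + 2 ->
  deg_range (q * f + q^-1 * g) (lg - 1) (hf + 1).
Proof.
move=> fP gP [[lf0 lfm] [hf0 hfm]] [[lg0 lgm] [hg0 hgm]] l h.
have coefE k : lcoef (q * f + q^-1 * g) k = - (lcoef f (k - 4) + lcoef g (k + 4)).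
  by rewrite lcoefD lcoef_mulq lcoef_mulqV; symmetry; apply: opprD.
have nz k : (lcoef f (4 * k - 4) != 0) || (lcoef g (4 * k + 4) != 0) ->
    lcoef (q * f + q^-1 * g) (4 * k) != 0.
  rewrite coefE.
  have -> : 4 * k - 4 = 4 * (k - 1) by ring.
  have -> : 4 * k + 4 = 4 * (k + 1) by ring.
  move: (fP (k - 1)) (gP (k + 1)) (signzS (k - 1)).
  rewrite subrK signzS oppr_eq0 => fa + e; rewrite e => gb; move: fa gb.
  move: (lcoef f _) (lcoef g _) => a b; case: (signz (k - 1)) => ->; lia.
have low k : lcoef (q * f + q^-1 * g) k != 0 ->
    lcoef f (k - 4) != 0 \/ lcoef g (k + 4) != 0.
  rewrite coefE; move: (lcoef f _) (lcoef g _) => a b; lia.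
split; split.
- by apply: nz; rewrite orbC (_ : 4 * (lg - 1) + 4 = 4 * lg) ?lg0 //; ring.
- by move=> k /low[/lfm|/lgm]; lia.
- by apply: nz; rewrite (_ : 4 * (hf + 1) - 4 = 4 * hf) ?hf0 //; ring.
- by move=> k /low[/hfm|/hgm]; lia.
Qed.

Lemma alternating1 : alternating 1.
Proof. by move=> k; rewrite lcoef1; case: (eqVneq k 0) => [->|k0] //; rewrite mulf_eq0 (negbTE k0) mulr0. Qed.

Lemma deg_range1 : deg_range 1 0 0.
Proof.
by rewrite /deg_range mulr0; split; split; rewrite ?lcoef1 // => k;
  rewrite lcoef1; case: (eqVneq k 0) => [->|_].
Qed.

Lemma sg_alternating f k : alternating f -> lcoef f (4 * k) != 0 ->
  Num.sg (lcoef f (4 * k)) = (-1) ^ k.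
Proof.
move=> /(_ k); case: (signz k) => ->; rewrite ?mul1r ?mulN1r ?oppr_ge0 => c0 cn.
  by apply: gtr0_sg; rewrite lt0r cn.
by apply: ltr0_sg; rewrite lt_neqAle cn.
Qed.

(** * From words to ancestor triangles *)

(** A vertex of the Stern-Brocot tree below the pair (y, z) lies strictly
    between y and z; fractions are compared by cross-multiplication because z
    may be oo. *)
Lemma descendant_between y z p (r := let yz := foldl sb_child (y, z) p in farey_sum yz.1 yz.2) :
  top_inv y z ->
  fnum y * denq r < numq r * fden y /\ numq r * fden z < fnum z * denq r.
Proof.
rewrite {}/r; elim: p y z => [|c p IH] y z yz /=.
  have [/eqP xy dx dy nx ny] := yz; have [/= -> ->] := farey_sumE (introT eqP xy) dx dy.
  by split; lia.
have [yzl yzr] := top_inv_sum yz; have [xy dx dy nx ny] := yz.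
have [/= nm dm] := farey_sumE xy dx dy.
by case: c => /=; [have /= := IH _ _ yzl | have /= := IH _ _ yzr]; rewrite nm dm;
  move: (numq _) (denq _) => a b; rewrite mulrDl mulrDr; lia.
Qed.

Lemma turn_child alpha i c p :
  alpha = (let yz := foldl sb_child (top alpha i) (c :: p) in farey_sum yz.1 yz.2) ->
  turn alpha i = (c != LetterL).
Proof.
have [topl topr] := top_inv_sum (top_invP alpha i).
rewrite /turn /bot; case: (top alpha i) topl topr => y z /= topl topr.
case: c => /= aE.
  have /= [_] := descendant_between p topl; rewrite -aE => h.
  apply/negbTE; rewrite -leNgt; apply: ltW.
  by rewrite -[X in is_true X]/(lt_rat _ _) lt_ratE.
have /= [h _] := descendant_between p topr; rewrite -aE in h.
by rewrite -[LHS]/(lt_rat _ _) lt_ratE.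
Qed.

Lemma top_child alpha i c p :
  alpha = (let yz := foldl sb_child (top alpha i) (c :: p) in farey_sum yz.1 yz.2) ->
  top alpha i.+1 = sb_child (top alpha i) c.
Proof.
move=> /turn_child; have -> : top alpha i.+1 = top_step alpha (top alpha i) by [].
by rewrite /turn /bot /top_step /sb_child => ->; case: c.
Qed.

(** Both inequalities between the ranges at the two parents are preserved by
    either step, so that each range is determined by one letter count. *)
Lemma bracket_descend alpha x i p ly hy lz hz :
  alpha = (let yz := foldl sb_child (top alpha i) p in farey_sum yz.1 yz.2) ->
  let f := corner_value alpha q x i true in
  let g := corner_value alpha q x i false in
  alternating f -> alternating g -> deg_range f ly hy -> deg_range g lz hz ->
  lz <= ly + 2 -> hz <= hy + 2 ->
  exists n, bot alpha n = alpha /\ alternating (apex_value alpha q x n) /\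
    deg_range (apex_value alpha q x n)
      (lz - (count_mem LetterL p)%:Z - 1) (hy + (count_mem LetterR p)%:Z + 1).
Proof.
elim: p i ly hy lz hz => [|c p IH] i ly hy lz hz aE f g fP gP fd gd l h.
  exists i; have mP : alternating (apex_value alpha q x i) := alternating_add fP gP.
  have md : deg_range (apex_value alpha q x i) (lz - 1) (hy + 1).
    exact (deg_range_add fP gP fd gd l h).
  by rewrite /= subr0 addr0; split=> //; exact (esym aE).
have tE := turn_child aE; have e := top_child aE.
have aE' : alpha = (let yz := foldl sb_child (top alpha i.+1) p in farey_sum yz.1 yz.2).
  by rewrite e.
have mP : alternating (apex_value alpha q x i) := alternating_add fP gP.
have md : deg_range (apex_value alpha q x i) (lz - 1) (hy + 1).
  exact (deg_range_add fP gP fd gd l h).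
have next := IH i.+1 _ _ _ _ aE'; rewrite !corner_valueS tE in next.
case: c {aE e tE} next => /= next.
  have [//||n [nE [nP nd]]] := next _ _ _ _ fP mP fd md; [lia|lia|exists n].
  have -> : lz - (1 + count_mem LetterL p)%N%:Z - 1 = lz - 1 - (count_mem LetterL p)%:Z - 1.
    by lia.
  by rewrite add0n; exact (conj nE (conj nP nd)).
have [||n [nE [nP nd]]] := next _ _ _ _ mP gP md gd; [lia|lia|exists n].
have -> : hy + (1 + count_mem LetterR p)%N%:Z + 1 = hy + 1 + (count_mem LetterR p)%:Z + 1.
  by lia.
by rewrite add0n; exact (conj nE (conj nP nd)).
Qed.

(** The images under v of phi(0) and phi(oo). *)
Definition seed (c : bool) : laurent := if c then 1 else A ^ 6 * delta.

Lemma rnumE alpha : 0 < alpha -> rnum alpha = size (chain alpha false (ntri alpha).-1).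
Proof. by move=> a0; rewrite /rnum side_right // size_rcons. Qed.

Lemma lnumE alpha : 0 < alpha -> lnum alpha = size (chain alpha true (ntri alpha).-1).
Proof. by move=> a0; rewrite /lnum side_left // size_rcons. Qed.

Lemma sum_wR alpha : 0 < alpha ->
  \sum_(g \in desc_paths None alpha) q ^ (wR alpha g)%:Z =
  q ^+ rnum alpha * apex_value alpha q (fun c => (c == false)%:R) (ntri alpha).-1.
Proof.
move=> a0; rewrite rnumE // /wR side_right //.
exact (path_sum a0 false q_unit).
Qed.

Lemma sum_wL alpha : 0 < alpha ->
  \sum_(g \in desc_paths (Some 0) alpha) q ^ (- (wL alpha g)%:Z) =
  q^-1 ^+ lnum alpha * apex_value alpha q (fun c => (c == true)%:R) (ntri alpha).-1.
Proof.
move=> a0; rewrite lnumE // /wL side_left //.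
have <- := path_sum a0 true q_unit.
by apply: eq_fsbigr => g _; rewrite -exprz_inv.
Qed.

(** The components of phi follow the recursion, with initial values (0, A^6) and
    (1, 0) at (0, oo), and v combines them linearly. *)
Lemma v_phi alpha : 0 < alpha ->
  v (phi (Some alpha)) = apex_value alpha q seed (ntri alpha).-1.
Proof.
move=> a0.
have phiE : phi (Some alpha) =
   (A ^ 6 * q ^ (- (rnum alpha)%:Z) *
      \sum_(g \in desc_paths None alpha) q ^ (wR alpha g)%:Z,
    q ^ (lnum alpha)%:Z *
      \sum_(g \in desc_paths (Some 0) alpha) q ^ (- (wL alpha g)%:Z)).
  by rewrite /phi gt_eqF.
have cancel n (x : laurent) : q ^ (- n%:Z) * (q ^+ n * x) = x.
  by rewrite mulrA -exprnN mulVr ?mul1r // unitrX ?q_unit.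
have cancel' n (x : laurent) : q ^ n%:Z * (q^-1 ^+ n * x) = x.
  by rewrite mulrA exprVn mulrV ?mul1r // unitrX ?q_unit.
rewrite phiE sum_wR // sum_wL // /v /= -[A ^ 6 * _ * _]mulrA cancel cancel'.
rewrite mulrAC; symmetry; apply: apex_value_linear => -[] /=.
  by rewrite mulr0 add0r.
by rewrite mulr1 addr0.
Qed.

(** The value at 1 = 0 # oo. *)
Lemma weighted_farey_1 : q + q^-1 * (A ^ 6 * delta) = 1.
Proof.
apply: (mulrI q_unit); rewrite mulrDr mulrA divrr ?q_unit // mul1r mulr1.
have e1 : A ^ 6 * A ^ (-2) = A ^ 4 by rewrite -exprzDr ?A_unit.
have e2 : A ^ 6 * A ^ 2 = A ^ 4 * A ^ 4 by rewrite -!exprzDr ?A_unit.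
rewrite /delta mulrDr !mulrN e1 e2 /q mulNr opprK; move: (A ^ 4) => x.
by rewrite addrA subrr add0r.
Qed.

Lemma top1 alpha : alpha < 1 -> turn alpha 0 = false /\ top alpha 1 = (Some 0, Some 1).
Proof.
move=> a1; have m1 : farey_sum (Some 0) None = 1 by [].
have nlt : (1 < alpha) = false by apply/negbTE; rewrite -leNgt; apply: ltW.
split; first by rewrite /turn /bot /= m1.
by rewrite /top /= /top_step /= m1 nlt.
Qed.

Lemma bracket_range w :
  alternating (bracket w) /\
  deg_range (bracket w) (- ((count_mem LetterL w)%:Z + 1)) ((count_mem LetterR w)%:Z + 1).
Proof.
have /andP[a0 a1] := rat_of_word_itv w; have [t0 top_1] := top1 a1.
rewrite /bracket v_phi //; set alpha := rat_of_word w in a0 a1 t0 top_1 *.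
have v0 : corner_value alpha q seed 1 true = 1 by rewrite corner_valueS t0.
have v1 : corner_value alpha q seed 1 false = 1.
  by rewrite corner_valueS t0 /= /apex_value /= mulr1 weighted_farey_1.
have aE : alpha = (let yz := foldl sb_child (top alpha 1) (rev w) in farey_sum yz.1 yz.2).
  by rewrite top_1.
have := @bracket_descend alpha seed 1 (rev w) 0 0 0 0 aE; rewrite v0 v1.
case/(_ alternating1 alternating1 deg_range1 deg_range1 isT isT) => n [nE [nP nd]].
have -> : (ntri alpha).-1 = n by apply: (@apex_inj alpha); rewrite apex_last // /apex nE.
split; first exact nP.
rewrite !count_rev !add0r -opprD in nd; exact nd.
Qed.

Theorem theorem3p19 (w : seq letter) :
  (is_mindeg (bracket w) (- 4 * ((count_mem LetterL w)%:Z + 1)) /\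
   is_maxdeg (bracket w) (4 * ((count_mem LetterR w)%:Z + 1))) /\
  (forall k : int, lcoef (bracket w) (4 * k) != 0 ->
     Num.sg (lcoef (bracket w) (4 * k)) = (-1) ^ k).
Proof.
have [alt [lo hi]] := bracket_range w; rewrite mulNr -mulrN.
by split; [split | move=> k; apply: sg_alternating].
Qed.
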